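(* Consider the parametric weighted random graph mixture model with $Q\ge 2$ groups, and assume: (A1) the $Q(Q+1)/2$ values $\theta_{ql}$, $1\le q\le l\le Q$, are pairwise distinct; (A2) the family $\mathcal M=\{F(\cdot,\theta):\theta\in\Theta\}$ satisfies: (i) no $F(\cdot,\theta)$ has a point mass at $0$; (ii) finite mixtures from $\mathcal M$ are identifiable up to label swapping, i.e. for every integer $r\ge1$, if $\sum_{i=1}^r a_iF(\cdot,\theta_i)=\sum_{i=1}^r a_i'F(\cdot,\theta_i')$ (with nonnegative weights summing to 1) then $\sum_{i=1}^r a_i\delta_{\theta_i}=\sum_{i=1}^r a_i'\delta_{\theta_i'}$. Then the parameters $\boldsymbol\pi$, $\theta_{ql}$, $p_{ql}$, $1\le q\le l\le Q$, are identifiable, up to label swapping, from the joint distribution of $K_3$.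
   Context: Random graph mixture model: nodes have i.i.d. latent groups $Z_i\in\{1,\dots,Q\}$ with $\pi_q=\mathbb P(Z_i=q)\in(0,1)$, $\sum_q\pi_q=1$; edge variables $X_{ij}$ ($i<j$) are conditionally independent given all $Z$'s, with law of $X_{ij}$ depending only on $(Z_i,Z_j)$. Parametric weighted model: $X_{ij}$ takes values in $\mathcal X=\mathbb N$, $\mathbb R$ or $\mathbb R^s$, and given $Z_i=q,Z_j=l$ has law $\mu_{ql}=(1-p_{ql})\delta_0+p_{ql}F(\cdot,\theta_{ql})$, where $p_{ql}=p_{lq}\in(0,1]$, $\theta_{ql}=\theta_{lq}\in\Theta\subset\mathbb R^p$, $\delta_0$ is the Dirac mass at $0$, and $F(\cdot,\theta)$ is a probability measure with a density w.r.t. counting or Lebesgue measure. $K_n$ denotes the collection of the $\binom n2$ edge variables among $n$ nodes. ''Up to label swapping'' means up to a permutation $\sigma$ of $\{1,\dots,Q\}$ applied simultaneously to all group-indexed parameters. *)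

(* Defs.v *)
From Stdlib Require Import Reals Lra Lia Classical ClassicalEpsilon.
Open Scope R_scope.

Fixpoint sumR (n : nat) (f : nat -> R) : R :=
  match n with
  | O => 0
  | S k => sumR k f + f k
  end.

Definition ind {T : Type} (A : T -> Prop) (x : T) : R :=
  if excluded_middle_informative (A x) then 1 else 0.

Definition is_sigma_algebra {X : Type} (S : (X -> Prop) -> Prop) : Prop :=
  S (fun _ => True) /\
  (forall A, S A -> S (fun x => ~ A x)) /\
  (forall A : nat -> X -> Prop, (forall n, S (A n)) -> S (fun x => exists n, A n x)).

Definition is_prob_measure {X : Type} (S : (X -> Prop) -> Prop)
  (m : (X -> Prop) -> R) : Prop :=
  (forall A, S A -> 0 <= m A) /\
  m (fun _ => True) = 1 /\
  (forall A : nat -> X -> Prop,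
     (forall n, S (A n)) ->
     (forall n k x, n <> k -> A n x -> A k x -> False) ->
     infinite_sum (fun n => m (A n)) (m (fun x => exists n, A n x))).

Definition dirac {X : Type} (x0 : X) (A : X -> Prop) : R := ind A x0.

Definition mixF {X Theta : Type} (F : Theta -> (X -> Prop) -> R)
  (r : nat) (a : nat -> R) (th : nat -> Theta) (A : X -> Prop) : R :=
  sumR r (fun i => a i * F (th i) A).

Definition mixDirac {Theta : Type} (r : nat) (a : nat -> R) (th : nat -> Theta)
  (B : Theta -> Prop) : R :=
  sumR r (fun i => a i * dirac (th i) B).

Definition mixtures_identifiable {X Theta : Type} (S : (X -> Prop) -> Prop)
  (F : Theta -> (X -> Prop) -> R) : Prop :=
  forall (r : nat) (a a' : nat -> R) (th th' : nat -> Theta),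
    (1 <= r)%nat ->
    (forall i, (i < r)%nat -> 0 <= a i) -> sumR r a = 1 ->
    (forall i, (i < r)%nat -> 0 <= a' i) -> sumR r a' = 1 ->
    (forall A, S A -> mixF F r a th A = mixF F r a' th' A) ->
    forall B : Theta -> Prop, mixDirac r a th B = mixDirac r a' th' B.

Definition mu {X Theta : Type} (x0 : X) (F : Theta -> (X -> Prop) -> R)
  (p : nat -> nat -> R) (th : nat -> nat -> Theta) (q l : nat) (A : X -> Prop) : R :=
  (1 - p q l) * dirac x0 A + p q l * F (th q l) A.

(* Joint law of K_3 = (X_12, X_13, X_23), evaluated on the measurable rectangle
   A1 x A2 x A3 (rectangles form a pi-system generating the product sigma-algebra,
   so these values determine the joint distribution):
   sum_{q,l,m} pi_q pi_l pi_m mu_ql(A1) mu_qm(A2) mu_lm(A3)  (Z1=q, Z2=l, Z3=m). *)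
Definition K3_law {X Theta : Type} (x0 : X) (F : Theta -> (X -> Prop) -> R)
  (Q : nat) (pi : nat -> R) (p : nat -> nat -> R) (th : nat -> nat -> Theta)
  (A1 A2 A3 : X -> Prop) : R :=
  sumR Q (fun q => sumR Q (fun l => sumR Q (fun m =>
    pi q * pi l * pi m *
    (mu x0 F p th q l A1 * mu x0 F p th q m A2 * mu x0 F p th l m A3)))).

Definition valid_params {Theta : Type} (Q : nat)
  (pi : nat -> R) (p : nat -> nat -> R) (th : nat -> nat -> Theta) : Prop :=
  (forall q, (q < Q)%nat -> 0 < pi q < 1) /\
  sumR Q pi = 1 /\
  (forall q l, (q < Q)%nat -> (l < Q)%nat ->
     0 < p q l <= 1 /\ p q l = p l q /\ th q l = th l q).

Definition thetas_distinct {Theta : Type} (Q : nat) (th : nat -> nat -> Theta) : Prop :=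
  forall q l q' l', (q <= l)%nat -> (l < Q)%nat -> (q' <= l')%nat -> (l' < Q)%nat ->
    th q l = th q' l' -> q = q' /\ l = l'.

Definition is_perm (Q : nat) (sigma : nat -> nat) : Prop :=
  (forall q, (q < Q)%nat -> (sigma q < Q)%nat) /\
  (forall q q', (q < Q)%nat -> (q' < Q)%nat -> sigma q = sigma q' -> q = q').

(* Main.v *)
(* Restricted to sets avoiding 0, the edge law mu_ql becomes p_ql F(., theta_ql),
   because F has no atom at 0.  The law of K_3 on such rectangles is therefore a
   finite mixture from {F(., theta)} indexed by triples of groups, and
   identifiability of mixtures lets us replace F(., theta_ql)(A) by the point mass
   delta_(theta_ql)(B), one edge at a time.  The result is a finite sum of point
   masses at (theta_Z1Z2, theta_Z1Z3, theta_Z2Z3).  As the theta_ql are distinct,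
   the atom at (theta'_qq, theta'_qq, theta'_qq) can only come from a diagonal
   theta_aa, which defines the permutation, and the atoms at
   (theta'_qq, theta'_ql, theta'_ql) match the off-diagonal values.  Comparing the
   weights of these atoms, with and without the third edge, recovers p and pi. *)

Require Import Defs.
From Stdlib Require Import Reals Lra Lia Arith Classical ClassicalEpsilon
  FunctionalExtensionality PropExtensionality.
Open Scope R_scope.

Lemma sumR_ext n f g :
  (forall i, (i < n)%nat -> f i = g i) -> sumR n f = sumR n g.
Proof.
  induction n as [|n IH]; intros H; simpl; [reflexivity|].
  rewrite IH by (intros; apply H; lia). rewrite H by lia. reflexivity.
Qed.

Lemma sumR_zero n : sumR n (fun _ => 0) = 0.
Proof. induction n as [|n IH]; simpl; lra. Qed.

Lemma sumR_nonneg n f : (forall i, (i < n)%nat -> 0 <= f i) -> 0 <= sumR n f.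
Proof.
  induction n as [|n IH]; intros H; simpl; [lra|].
  assert (0 <= f n) by (apply H; lia).
  assert (0 <= sumR n f) by (apply IH; intros; apply H; lia).
  lra.
Qed.

Lemma sumR_scal n c f : sumR n (fun i => c * f i) = c * sumR n f.
Proof. induction n as [|n IH]; simpl; [|rewrite IH]; lra. Qed.

Lemma sumR_add m n f :
  sumR (m + n) f = sumR m f + sumR n (fun j => f (m + j)%nat).
Proof.
  induction n as [|n IH]; simpl.
  - rewrite Nat.add_0_r; lra.
  - rewrite Nat.add_succ_r; simpl; rewrite IH; lra.
Qed.

Lemma sumR_neq0 n f : sumR n f <> 0 -> exists i, (i < n)%nat /\ f i <> 0.
Proof.
  induction n as [|n IH]; simpl; intros H; [lra|].
  destruct (Req_dec (f n) 0) as [E|E].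
  - destruct IH as [i [Hi Hf]]; [lra|]. exists i; split; [lia | exact Hf].
  - exists n; split; [lia | exact E].
Qed.

Lemma sumR_single n f a : (a < n)%nat ->
  (forall i, (i < n)%nat -> i <> a -> f i = 0) -> sumR n f = f a.
Proof.
  induction n as [|n IH]; simpl; intros Ha H; [lia|].
  destruct (Nat.eq_dec a n) as [->|Ne].
  - rewrite (sumR_ext n f (fun _ => 0)), sumR_zero by (intros; apply H; lia). lra.
  - rewrite IH, (H n) by (try lia; intros; apply H; lia). lra.
Qed.

Lemma sumR_nested n m g : (0 < m)%nat ->
  sumR n (fun i => sumR m (g i)) = sumR (n * m) (fun k => g (k / m) (k mod m))%nat.
Proof.
  intros Hm. induction n as [|n IH]; simpl; [reflexivity|].
  rewrite Nat.add_comm, sumR_add, IH. f_equal. apply sumR_ext. intros j Hj.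
  replace (n * m + j)%nat with (j + n * m)%nat by lia.
  rewrite Nat.div_add, Nat.Div0.mod_add, Nat.div_small, Nat.mod_small by lia.
  reflexivity.
Qed.

Definition sum3 (Q : nat) (g : nat -> nat -> nat -> R) : R :=
  sumR Q (fun q => sumR Q (fun l => sumR Q (g q l))).

Lemma sum3_ext Q g h :
  (forall q l m, (q < Q)%nat -> (l < Q)%nat -> (m < Q)%nat -> g q l m = h q l m) ->
  sum3 Q g = sum3 Q h.
Proof.
  intros H. unfold sum3.
  apply sumR_ext; intros. apply sumR_ext; intros. apply sumR_ext; intros. auto.
Qed.

Lemma sum3_neq0 Q g : sum3 Q g <> 0 ->
  exists q l m, (q < Q)%nat /\ (l < Q)%nat /\ (m < Q)%nat /\ g q l m <> 0.
Proof.
  intros H.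
  destruct (sumR_neq0 _ _ H) as [q [Hq H1]].
  destruct (sumR_neq0 _ _ H1) as [l [Hl H2]].
  destruct (sumR_neq0 _ _ H2) as [m [Hm H3]].
  exists q, l, m; auto.
Qed.

Lemma sum3_single Q g a b c : (a < Q)%nat -> (b < Q)%nat -> (c < Q)%nat ->
  (forall q l m, (q < Q)%nat -> (l < Q)%nat -> (m < Q)%nat ->
     g q l m <> 0 -> q = a /\ l = b /\ m = c) ->
  sum3 Q g = g a b c.
Proof.
  intros Ha Hb Hc H.
  assert (Z : forall q l m, (q < Q)%nat -> (l < Q)%nat -> (m < Q)%nat ->
            ~ (q = a /\ l = b /\ m = c) -> g q l m = 0).
  { intros q l m Hq Hl Hm N. apply NNPP. intros E. exact (N (H q l m Hq Hl Hm E)). }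
  unfold sum3. rewrite (sumR_single _ _ a), (sumR_single _ _ b), (sumR_single _ _ c); auto.
  - intros m Hm Ne. apply Z; auto; lia.
  - intros l Hl Ne. rewrite <- (sumR_zero Q). apply sumR_ext; intros m Hm. apply Z; auto; lia.
  - intros q Hq Ne. rewrite <- (sumR_zero Q). apply sumR_ext; intros l Hl.
    rewrite <- (sumR_zero Q). apply sumR_ext; intros m Hm. apply Z; auto; lia.
Qed.

Definition idx1 Q k := (k / (Q * Q))%nat.
Definition idx2 Q k := (k mod (Q * Q) / Q)%nat.
Definition idx3 Q k := (k mod (Q * Q) mod Q)%nat.

Lemma sum3_flatten Q g : (0 < Q)%nat ->
  sum3 Q g = sumR (Q * (Q * Q)) (fun k => g (idx1 Q k) (idx2 Q k) (idx3 Q k)).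
Proof.
  intros HQ. unfold sum3.
  rewrite (sumR_ext Q _ (fun q => sumR (Q * Q) (fun k => g q (k / Q) (k mod Q))%nat))
    by (intros; apply sumR_nested; exact HQ).
  apply (sumR_nested Q (Q * Q) (fun q k => g q (k / Q) (k mod Q))%nat). lia.
Qed.

Lemma idx_lt Q k : (0 < Q)%nat -> (k < Q * (Q * Q))%nat ->
  (idx1 Q k < Q)%nat /\ (idx2 Q k < Q)%nat /\ (idx3 Q k < Q)%nat.
Proof.
  intros HQ Hk. unfold idx1, idx2, idx3.
  assert (k mod (Q * Q) < Q * Q)%nat by (apply Nat.mod_upper_bound; lia).
  repeat split.
  - apply Nat.Div0.div_lt_upper_bound. lia.
  - apply Nat.Div0.div_lt_upper_bound. lia.
  - apply Nat.mod_upper_bound. lia.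
Qed.

Lemma set_ext {X : Type} (A B : X -> Prop) : (forall x, A x <-> B x) -> A = B.
Proof.
  intros H. apply functional_extensionality; intros x.
  apply propositional_extensionality, H.
Qed.

Section Measure.
Context {X : Type} {Sig : (X -> Prop) -> Prop}.
Hypothesis HS : is_sigma_algebra Sig.

Lemma sigma_full : Sig (fun _ => True).
Proof. apply HS. Qed.

Lemma sigma_compl A : Sig A -> Sig (fun x => ~ A x).
Proof. apply HS. Qed.

Lemma sigma_empty : Sig (fun _ => False).
Proof.
  replace (fun _ : X => False) with (fun _ : X => ~ True) by (apply set_ext; tauto).
  apply sigma_compl, sigma_full.
Qed.

Lemma sigma_union A B : Sig A -> Sig B -> Sig (fun x => A x \/ B x).
Proof.
  intros HA HB.
  replace (fun x => A x \/ B x)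
    with (fun x => exists n, (match n with O => A | _ => B end) x).
  - apply HS. intros [|n]; assumption.
  - apply set_ext. intros x; split.
    + intros [[|n] H]; auto.
    + intros [H|H]; [exists O | exists 1%nat]; exact H.
Qed.

Lemma sigma_inter A B : Sig A -> Sig B -> Sig (fun x => A x /\ B x).
Proof.
  intros HA HB.
  replace (fun x => A x /\ B x) with (fun x => ~ (~ A x \/ ~ B x))
    by (apply set_ext; intros x; tauto).
  apply sigma_compl, sigma_union; apply sigma_compl; assumption.
Qed.

Context {m : (X -> Prop) -> R}.
Hypothesis Hm : is_prob_measure Sig m.

Lemma measure_nonneg A : Sig A -> 0 <= m A.
Proof. apply Hm. Qed.

Lemma measure_full : m (fun _ => True) = 1.
Proof. apply Hm. Qed.

Lemma measure_empty : m (fun _ => False) = 0.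
Proof.
  pose proof (proj2 (proj2 Hm) (fun _ _ => False)) as Hc. cbv beta in Hc.
  replace (fun x : X => exists n : nat, False) with (fun _ : X => False) in Hc
    by (apply set_ext; intros x; split; [tauto | intros [_ []]]).
  specialize (Hc (fun _ => sigma_empty) (fun _ _ _ _ H _ => H)).
  set (c := m (fun _ => False)) in *.
  (* the partial sums (n+1) c can only converge to c if c = 0 *)
  apply NNPP. intros Hc0.
  destruct (Hc (Rabs c)) as [N HN]; [apply Rabs_pos_lt; exact Hc0|].
  specialize (HN (S N) (Nat.le_succ_diag_r N)).
  assert (Hsum : forall n, sum_f_R0 (fun _ => c) n = INR (S n) * c).
  { induction n as [|n IH]; simpl sum_f_R0; [simpl; lra | rewrite IH, (S_INR (S n)); lra]. }
  rewrite Hsum in HN. unfold Rdist in HN.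
  replace (INR (S (S N)) * c - c) with (INR (S N) * c) in HN by (rewrite (S_INR (S N)); ring).
  rewrite Rabs_mult, (Rabs_right (INR (S N))) in HN by apply Rle_ge, pos_INR.
  pose proof (Rabs_pos c). rewrite S_INR in HN. pose proof (pos_INR N). nra.
Qed.

Lemma measure_add A B : Sig A -> Sig B -> (forall x, A x -> B x -> False) ->
  m (fun x => A x \/ B x) = m A + m B.
Proof.
  intros HA HB D.
  set (U n := match n with O => A | 1%nat => B | _ => fun _ : X => False end).
  assert (HU : infinite_sum (fun n => m (U n)) (m (fun x => A x \/ B x))).
  { replace (fun x => A x \/ B x) with (fun x => exists n, U n x).
    - apply (proj2 (proj2 Hm)).
      + intros [|[|n]]; [exact HA | exact HB | apply sigma_empty].
      + intros [|[|n]] [|[|k]] x Ne H1 H2; simpl in *; try lia; eauto.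
    - apply set_ext. intros x; split.
      + intros [[|[|n]] H]; simpl in H; tauto.
      + intros [H|H]; [exists O | exists 1%nat]; exact H. }
  apply (uniqueness_sum _ _ _ HU). intros eps Heps. exists 1%nat. intros n Hn.
  replace (sum_f_R0 (fun n => m (U n)) n) with (m A + m B).
  { unfold Rdist. rewrite Rminus_diag, Rabs_R0. exact Heps. }
  induction n as [|[|n] IH]; [lia | reflexivity |].
  simpl sum_f_R0 in *. rewrite <- IH by lia. unfold U. rewrite measure_empty. lra.
Qed.

Lemma measure_remove_null_point A x0 : Sig A -> Sig (fun x => x = x0) ->
  m (fun x => x = x0) = 0 -> m (fun x => A x /\ x <> x0) = m A.
Proof.
  intros HA H0 Z.
  assert (HAc : Sig (fun x => A x /\ x <> x0))
    by (apply sigma_inter; [exact HA | apply sigma_compl, H0]).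
  assert (HA0 : Sig (fun x => A x /\ x = x0)) by (apply sigma_inter; assumption).
  assert (HnA0 : Sig (fun x => ~ A x /\ x = x0))
    by (apply sigma_inter; [apply sigma_compl, HA | exact H0]).
  assert (E1 : m A = m (fun x => A x /\ x <> x0) + m (fun x => A x /\ x = x0)).
  { rewrite <- measure_add by (try assumption; intros x [_ a] [_ b]; auto).
    f_equal. apply set_ext. intros x. destruct (classic (x = x0)); tauto. }
  assert (E2 : m (fun x => x = x0) = m (fun x => A x /\ x = x0) + m (fun x => ~ A x /\ x = x0)).
  { rewrite <- measure_add by (try assumption; intros x [a _] [b _]; auto).
    f_equal. apply set_ext. intros x. destruct (classic (A x)); tauto. }
  pose proof (measure_nonneg _ HA0). pose proof (measure_nonneg _ HnA0).
  lra.
Qed.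

End Measure.

Definition pad {T : Type} (r : nat) (f : nat -> T) (d : T) (i : nat) : T :=
  if lt_dec i r then f i else d.

Lemma sumR_pad {T : Type} r (w : nat -> R) (tau : nat -> T) (t0 : T) (g : T -> R) c :
  sumR (S r) (fun i => c * pad r w 1 i * g (pad r tau t0 i)) =
  c * (sumR r (fun i => w i * g (tau i)) + g t0).
Proof.
  unfold pad; simpl. destruct (lt_dec r r) as [Hr|_]; [lia|].
  rewrite (sumR_ext r _ (fun i => c * (w i * g (tau i)))), sumR_scal; [ring|].
  intros i Hi. destruct (lt_dec i r); [ring | lia].
Qed.

Definition psi_term (pi : nat -> R) (f1 f2 f3 : nat -> nat -> R) (q l m : nat) : R :=
  pi q * pi l * pi m * (f1 q l * f2 q m * f3 l m).

(* [Psi Q pi f1 f2 f3] is the expectation of f1(Z1,Z2) f2(Z1,Z3) f3(Z2,Z3). *)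
Definition Psi (Q : nat) (pi : nat -> R) (f1 f2 f3 : nat -> nat -> R) : R :=
  sum3 Q (psi_term pi f1 f2 f3).

Definition edge {Theta : Type} (p : nat -> nat -> R) (th : nat -> nat -> Theta)
    (h : Theta -> R) (q l : nat) : R :=
  p q l * h (th q l).

Definition nonneg_on (Q : nat) (f : nat -> nat -> R) : Prop :=
  forall q l, (q < Q)%nat -> (l < Q)%nat -> 0 <= f q l.

Lemma psi_term_nonneg Q pi f1 f2 f3 : (forall q, (q < Q)%nat -> 0 <= pi q) ->
  nonneg_on Q f1 -> nonneg_on Q f2 -> nonneg_on Q f3 ->
  forall q l m, (q < Q)%nat -> (l < Q)%nat -> (m < Q)%nat -> 0 <= psi_term pi f1 f2 f3 q l m.
Proof.
  intros Hpi H1 H2 H3 q l m Hq Hl Hm. unfold psi_term.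
  pose proof (Hpi q Hq). pose proof (Hpi l Hl). pose proof (Hpi m Hm).
  pose proof (H1 q l Hq Hl). pose proof (H2 q m Hq Hm). pose proof (H3 l m Hl Hm).
  repeat apply Rmult_le_pos; assumption.
Qed.

Section EdgeFactor.
Variables (Theta : Type) (Q : nat) (pi : nat -> R) (p : nat -> nat -> R)
  (th : nat -> nat -> Theta) (h : Theta -> R).

Lemma Psi_edge1 f2 f3 : Psi Q pi (edge p th h) f2 f3 =
  sum3 Q (fun q l m => psi_term pi p f2 f3 q l m * h (th q l)).
Proof. apply sum3_ext. intros. unfold psi_term, edge. ring. Qed.

Lemma Psi_edge2 f1 f3 : Psi Q pi f1 (edge p th h) f3 =
  sum3 Q (fun q l m => psi_term pi f1 p f3 q l m * h (th q m)).
Proof. apply sum3_ext. intros. unfold psi_term, edge. ring. Qed.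

Lemma Psi_edge3 f1 f2 : Psi Q pi f1 f2 (edge p th h) =
  sum3 Q (fun q l m => psi_term pi f1 f2 p q l m * h (th l m)).
Proof. apply sum3_ext. intros. unfold psi_term, edge. ring. Qed.

End EdgeFactor.

Section Mixtures.
Context {X Theta : Type} {Sig : (X -> Prop) -> Prop} {F : Theta -> (X -> Prop) -> R}.
Hypotheses (HS : is_sigma_algebra Sig) (HF : forall t, is_prob_measure Sig (F t))
  (Hid : mixtures_identifiable Sig F).

(* Identifiability for arbitrary nonnegative weights: equal total masses are
   forced by evaluating at the full set, and padding both mixtures with one
   common extra atom makes the total positive, so they can be normalised. *)
Lemma mixDirac_eq_of_mixF_eq (t0 : Theta) r (w w' : nat -> R) (tau tau' : nat -> Theta) :
  (forall i, (i < r)%nat -> 0 <= w i) -> (forall i, (i < r)%nat -> 0 <= w' i) ->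
  (forall A, Sig A -> mixF F r w tau A = mixF F r w' tau' A) ->
  forall B, mixDirac r w tau B = mixDirac r w' tau' B.
Proof.
  intros Hw Hw' Heq B.
  assert (Hmass : forall v tv, mixF F r v tv (fun _ => True) = sumR r v).
  { intros v tv. apply sumR_ext. intros i _. rewrite (measure_full (HF _)). ring. }
  assert (ET : sumR r w = sumR r w').
  { rewrite <- (Hmass w tau), <- (Hmass w' tau'). apply Heq, sigma_full, HS. }
  set (T := sumR r w) in *.
  assert (T0 : 0 <= T) by (apply sumR_nonneg, Hw).
  set (c := / (T + 1)).
  assert (Hc : 0 < c) by (apply Rinv_0_lt_compat; lra).
  assert (Hpad : forall v, (forall i, (i < r)%nat -> 0 <= v i) ->
            forall i, (i < S r)%nat -> 0 <= c * pad r v 1 i).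
  { intros v Hv i _. unfold pad. destruct (lt_dec i r); apply Rmult_le_pos; auto; lra. }
  assert (Htot : forall v, sumR r v = T -> sumR (S r) (fun i => c * pad r v 1 i) = 1).
  { intros v Hv.
    transitivity (sumR (S r) (fun i => c * pad r v 1 i * (fun _ : Theta => 1) (pad r tau t0 i))).
    { apply sumR_ext; intros; ring. }
    rewrite (sumR_pad r v tau t0 (fun _ => 1) c), (sumR_ext r _ v), Hv by (intros; ring).
    unfold c. field. lra. }
  pose proof (Hid (S r) (fun i => c * pad r w 1 i) (fun i => c * pad r w' 1 i)
                (pad r tau t0) (pad r tau' t0) ltac:(lia)
                (Hpad w Hw) (Htot w eq_refl) (Hpad w' Hw') (Htot w' (eq_sym ET))) as Hd.
  assert (Hmix : forall A, Sig A ->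
            mixF F (S r) (fun i => c * pad r w 1 i) (pad r tau t0) A =
            mixF F (S r) (fun i => c * pad r w' 1 i) (pad r tau' t0) A).
  { intros A HA. unfold mixF.
    rewrite (sumR_pad r w tau t0 (fun t => F t A)), (sumR_pad r w' tau' t0 (fun t => F t A)).
    fold (mixF F r w tau A) (mixF F r w' tau' A). rewrite Heq by exact HA. reflexivity. }
  specialize (Hd Hmix B). unfold mixDirac in Hd |- *.
  rewrite (sumR_pad r w tau t0 (fun t => dirac t B)),
    (sumR_pad r w' tau' t0 (fun t => dirac t B)) in Hd.
  apply Rmult_eq_reg_l in Hd; lra.
Qed.

Lemma sum3_dirac_eq_of_mixture_eq Q (g g' : nat -> nat -> nat -> R)
    (tau tau' : nat -> nat -> nat -> Theta) : (0 < Q)%nat ->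
  (forall q l m, (q < Q)%nat -> (l < Q)%nat -> (m < Q)%nat -> 0 <= g q l m) ->
  (forall q l m, (q < Q)%nat -> (l < Q)%nat -> (m < Q)%nat -> 0 <= g' q l m) ->
  (forall A, Sig A -> sum3 Q (fun q l m => g q l m * F (tau q l m) A) =
                      sum3 Q (fun q l m => g' q l m * F (tau' q l m) A)) ->
  forall B, sum3 Q (fun q l m => g q l m * dirac (tau q l m) B) =
            sum3 Q (fun q l m => g' q l m * dirac (tau' q l m) B).
Proof.
  intros HQ Hg Hg' Heq B. rewrite !sum3_flatten by exact HQ.
  apply (mixDirac_eq_of_mixF_eq (tau 0 0 0)%nat _
           (fun k => g (idx1 Q k) (idx2 Q k) (idx3 Q k))
           (fun k => g' (idx1 Q k) (idx2 Q k) (idx3 Q k))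
           (fun k => tau (idx1 Q k) (idx2 Q k) (idx3 Q k))
           (fun k => tau' (idx1 Q k) (idx2 Q k) (idx3 Q k))).
  - intros k Hk. destruct (idx_lt Q k HQ Hk) as [? [? ?]]. auto.
  - intros k Hk. destruct (idx_lt Q k HQ Hk) as [? [? ?]]. auto.
  - intros A HA. unfold mixF.
    rewrite <- (sum3_flatten Q (fun q l m => g q l m * F (tau q l m) A)),
      <- (sum3_flatten Q (fun q l m => g' q l m * F (tau' q l m) A)) by exact HQ.
    apply Heq, HA.
Qed.

Section Replace.
Variables (Q : nat) (HQ : (0 < Q)%nat) (pi pi' : nat -> R)
  (p p' : nat -> nat -> R) (th th' : nat -> nat -> Theta).
Hypotheses (Hpi : forall q, (q < Q)%nat -> 0 <= pi q) (Hpi' : forall q, (q < Q)%nat -> 0 <= pi' q)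
  (Hp : nonneg_on Q p) (Hp' : nonneg_on Q p').

Lemma Psi_dirac_edge1 f2 f2' f3 f3' :
  nonneg_on Q f2 -> nonneg_on Q f2' -> nonneg_on Q f3 -> nonneg_on Q f3' ->
  (forall A, Sig A -> Psi Q pi (edge p th (fun t => F t A)) f2 f3 =
                      Psi Q pi' (edge p' th' (fun t => F t A)) f2' f3') ->
  forall B, Psi Q pi (edge p th (fun t => dirac t B)) f2 f3 =
            Psi Q pi' (edge p' th' (fun t => dirac t B)) f2' f3'.
Proof.
  intros H2 H2' H3 H3' Heq B. rewrite !Psi_edge1.
  apply sum3_dirac_eq_of_mixture_eq; try apply psi_term_nonneg; auto.
  intros A HA. rewrite <- !(Psi_edge1 _ _ _ _ _ (fun t => F t A)). apply Heq, HA.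
Qed.

Lemma Psi_dirac_edge2 f1 f1' f3 f3' :
  nonneg_on Q f1 -> nonneg_on Q f1' -> nonneg_on Q f3 -> nonneg_on Q f3' ->
  (forall A, Sig A -> Psi Q pi f1 (edge p th (fun t => F t A)) f3 =
                      Psi Q pi' f1' (edge p' th' (fun t => F t A)) f3') ->
  forall B, Psi Q pi f1 (edge p th (fun t => dirac t B)) f3 =
            Psi Q pi' f1' (edge p' th' (fun t => dirac t B)) f3'.
Proof.
  intros H1 H1' H3 H3' Heq B. rewrite !Psi_edge2.
  apply sum3_dirac_eq_of_mixture_eq; try apply psi_term_nonneg; auto.
  intros A HA. rewrite <- !(Psi_edge2 _ _ _ _ _ (fun t => F t A)). apply Heq, HA.
Qed.

Lemma Psi_dirac_edge3 f1 f1' f2 f2' :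
  nonneg_on Q f1 -> nonneg_on Q f1' -> nonneg_on Q f2 -> nonneg_on Q f2' ->
  (forall A, Sig A -> Psi Q pi f1 f2 (edge p th (fun t => F t A)) =
                      Psi Q pi' f1' f2' (edge p' th' (fun t => F t A))) ->
  forall B, Psi Q pi f1 f2 (edge p th (fun t => dirac t B)) =
            Psi Q pi' f1' f2' (edge p' th' (fun t => dirac t B)).
Proof.
  intros H1 H1' H2 H2' Heq B. rewrite !Psi_edge3.
  apply sum3_dirac_eq_of_mixture_eq; try apply psi_term_nonneg; auto.
  intros A HA. rewrite <- !(Psi_edge3 _ _ _ _ _ (fun t => F t A)). apply Heq, HA.
Qed.

End Replace.

End Mixtures.

Lemma dirac_self {T : Type} (v : T) : dirac v (fun t => t = v) = 1.
Proof. unfold dirac, Defs.ind. destruct (excluded_middle_informative (v = v)); tauto. Qed.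

Lemma dirac_singleton_neq0 {T : Type} (v x : T) : dirac x (fun t => t = v) <> 0 -> x = v.
Proof. unfold dirac, Defs.ind. destruct (excluded_middle_informative (x = v)); [auto | lra]. Qed.

Lemma dirac_nonneg {T : Type} (x : T) B : 0 <= dirac x B.
Proof. unfold dirac, Defs.ind. destruct (excluded_middle_informative (B x)); lra. Qed.

Lemma psi_term_neq0 pi f1 f2 f3 q l m : psi_term pi f1 f2 f3 q l m <> 0 ->
  f1 q l <> 0 /\ f2 q m <> 0 /\ f3 l m <> 0.
Proof. intros H; repeat split; intros E; apply H; unfold psi_term; rewrite E; ring. Qed.

Notation point_edge p th v := (edge p th (fun t => dirac t (fun s => s = v))).

Lemma point_edge_neq0 {Theta : Type} p (th : nat -> nat -> Theta) v q l :
  point_edge p th v q l <> 0 -> th q l = v.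
Proof.
  unfold edge. intros H. apply dirac_singleton_neq0.
  intros E; apply H; rewrite E; ring.
Qed.

Lemma Psi_point_support {Theta : Type} Q pi p (th : nat -> nat -> Theta) v1 v2 v3 :
  Psi Q pi (point_edge p th v1) (point_edge p th v2) (point_edge p th v3) <> 0 ->
  exists q l m, (q < Q)%nat /\ (l < Q)%nat /\ (m < Q)%nat /\
    th q l = v1 /\ th q m = v2 /\ th l m = v3.
Proof.
  intros H. destruct (sum3_neq0 _ _ H) as [q [l [m [Hq [Hl [Hm Ht]]]]]].
  destruct (psi_term_neq0 _ _ _ _ _ _ _ Ht) as [H1 [H2 H3]].
  exists q, l, m. repeat split; auto; eapply point_edge_neq0; eassumption.
Qed.

Section PointMasses.
Context {Theta : Type} {Q : nat} {pi : nat -> R} {p : nat -> nat -> R}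
  {th : nat -> nat -> Theta}.
Hypotheses (Hv : valid_params Q pi p th) (Hd : thetas_distinct Q th).

Lemma valid_pi_pos q : (q < Q)%nat -> 0 < pi q.
Proof. intros Hq. apply Hv, Hq. Qed.

Lemma valid_p_pos q l : (q < Q)%nat -> (l < Q)%nat -> 0 < p q l.
Proof. intros Hq Hl. apply (proj2 (proj2 Hv) q l Hq Hl). Qed.

Lemma theta_eq_cases a b c d : (a < Q)%nat -> (b < Q)%nat -> (c < Q)%nat -> (d < Q)%nat ->
  th a b = th c d -> (a = c /\ b = d) \/ (a = d /\ b = c).
Proof.
  intros Ha Hb Hc Hd' E.
  assert (Hsym : forall x y, (x < Q)%nat -> (y < Q)%nat -> th x y = th y x)
    by (intros x y Hx Hy; apply (proj2 (proj2 Hv) x y Hx Hy)).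
  destruct (le_lt_dec a b), (le_lt_dec c d).
  - left. apply Hd; auto.
  - rewrite (Hsym c d) in E by assumption.
    right. destruct (Hd a b d c) as [-> ->]; auto; lia.
  - rewrite (Hsym a b) in E by assumption.
    right. destruct (Hd b a c d) as [-> ->]; auto; lia.
  - rewrite (Hsym a b), (Hsym c d) in E by assumption.
    left. destruct (Hd b a d c) as [-> ->]; auto; lia.
Qed.

Lemma Psi_point_diag a f3 : (a < Q)%nat ->
  Psi Q pi (point_edge p th (th a a)) (point_edge p th (th a a)) f3 =
  pi a * pi a * pi a * (p a a * p a a * f3 a a).
Proof.
  intros Ha. unfold Psi. rewrite (sum3_single Q _ a a a); auto.
  - unfold psi_term, edge. rewrite dirac_self. ring.
  - intros q l m Hq Hl Hm [H1 [H2 _]]%psi_term_neq0.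
    apply point_edge_neq0 in H1, H2.
    destruct (theta_eq_cases q l a a) as [[-> ->]|[-> ->]]; auto;
    destruct (theta_eq_cases a m a a) as [[_ ->]|[_ ->]]; auto.
Qed.

Lemma Psi_point_offdiag a b f3 : (a < Q)%nat -> (b < Q)%nat -> a <> b ->
  Psi Q pi (point_edge p th (th a a)) (point_edge p th (th a b)) f3 =
  pi a * pi a * pi b * (p a a * p a b * f3 a b).
Proof.
  intros Ha Hb Nab. unfold Psi. rewrite (sum3_single Q _ a a b); auto.
  - unfold psi_term, edge. rewrite !dirac_self. ring.
  - intros q l m Hq Hl Hm [H1 [H2 _]]%psi_term_neq0.
    apply point_edge_neq0 in H1, H2.
    destruct (theta_eq_cases q l a a) as [[-> ->]|[-> ->]]; auto;
    destruct (theta_eq_cases a m a b) as [[_ ->]|[-> ->]]; auto.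
Qed.

End PointMasses.

Lemma cube_inj x y : 0 < x -> 0 < y -> x * x * x = y * y * y -> x = y.
Proof.
  intros Hx Hy E. destruct (Rtotal_order x y) as [L|[L|L]]; [exfalso | exact L | exfalso].
  - assert (x * x < y * y) by nra. nra.
  - assert (y * y < x * x) by nra. nra.
Qed.

Section Identification.
Context {Theta : Type} {Q : nat} {pi pi' : nat -> R} {p p' : nat -> nat -> R}
  {th th' : nat -> nat -> Theta}.
Hypotheses (Hv : valid_params Q pi p th) (Hv' : valid_params Q pi' p' th')
  (Hd : thetas_distinct Q th) (Hd' : thetas_distinct Q th').
Hypothesis law3 : forall B1 B2 B3,
  Psi Q pi (edge p th (fun t => dirac t B1)) (edge p th (fun t => dirac t B2))
    (edge p th (fun t => dirac t B3)) =
  Psi Q pi' (edge p' th' (fun t => dirac t B1)) (edge p' th' (fun t => dirac t B2))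
    (edge p' th' (fun t => dirac t B3)).
Hypothesis law2 : forall B1 B2,
  Psi Q pi (edge p th (fun t => dirac t B1)) (edge p th (fun t => dirac t B2)) (fun _ _ => 1) =
  Psi Q pi' (edge p' th' (fun t => dirac t B1)) (edge p' th' (fun t => dirac t B2)) (fun _ _ => 1).

Lemma diag_theta_match q : (q < Q)%nat -> exists a, (a < Q)%nat /\ th a a = th' q q.
Proof.
  intros Hq. set (v := th' q q).
  destruct (Psi_point_support Q pi p th v v v) as [a [l [m [Ha [Hl [Hm [T1 [T2 T3]]]]]]]].
  { rewrite law3. unfold v. rewrite Psi_point_diag by assumption.
    unfold edge. rewrite dirac_self.
    pose proof (valid_pi_pos Hv' q Hq). pose proof (valid_p_pos Hv' q q Hq Hq).
    apply Rgt_not_eq. repeat apply Rmult_lt_0_compat; lra. }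
  exists m. split; [exact Hm|].
  rewrite <- T3. rewrite <- T2 in T1.
  destruct (theta_eq_cases Hv Hd a l a m) as [[_ ->]|[-> ->]]; auto.
Qed.

Definition sigma (q : nat) : nat :=
  epsilon (inhabits 0%nat) (fun a => (a < Q)%nat /\ th a a = th' q q).

Lemma sigma_spec q : (q < Q)%nat -> (sigma q < Q)%nat /\ th (sigma q) (sigma q) = th' q q.
Proof. intros Hq. unfold sigma. apply epsilon_spec, diag_theta_match, Hq. Qed.

Lemma sigma_inj q q' : (q < Q)%nat -> (q' < Q)%nat -> sigma q = sigma q' -> q = q'.
Proof.
  intros Hq Hq' E.
  destruct (sigma_spec q Hq) as [_ E1], (sigma_spec q' Hq') as [_ E2].
  rewrite E, E2 in E1. destruct (Hd' q' q' q q) as [-> _]; auto.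
Qed.

Lemma row_theta_match q l : (q < Q)%nat -> (l < Q)%nat -> q <> l ->
  exists m, (m < Q)%nat /\ th (sigma q) m = th' q l.
Proof.
  intros Hq Hl Nql.
  destruct (Psi_point_support Q pi p th (th' q q) (th' q l) (th' q l))
    as [a [b [m [Ha [Hb [Hm [T1 [T2 _]]]]]]]].
  { rewrite law3, Psi_point_offdiag by assumption.
    unfold edge. rewrite dirac_self.
    pose proof (valid_pi_pos Hv' q Hq). pose proof (valid_pi_pos Hv' l Hl).
    pose proof (valid_p_pos Hv' q q Hq Hq). pose proof (valid_p_pos Hv' q l Hq Hl).
    apply Rgt_not_eq. repeat apply Rmult_lt_0_compat; lra. }
  destruct (sigma_spec q Hq) as [Hs Es]. rewrite <- Es in T1.
  exists m. split; [exact Hm|]. rewrite <- T2.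
  destruct (theta_eq_cases Hv Hd a b (sigma q) (sigma q)) as [[-> _]|[-> _]]; auto.
Qed.

Lemma theta_match q l : (q < Q)%nat -> (l < Q)%nat -> th' q l = th (sigma q) (sigma l).
Proof.
  intros Hq Hl. destruct (Nat.eq_dec q l) as [<-|Nql].
  { symmetry. apply sigma_spec, Hq. }
  destruct (row_theta_match q l Hq Hl Nql) as [m1 [Hm1 T1]].
  destruct (row_theta_match l q Hl Hq (not_eq_sym Nql)) as [m2 [Hm2 T2]].
  rewrite (proj2 (proj2 (proj2 (proj2 Hv') l q Hl Hq))), <- T1 in T2.
  destruct (sigma_spec q Hq) as [Sq _], (sigma_spec l Hl) as [Sl _].
  destruct (theta_eq_cases Hv Hd (sigma l) m2 (sigma q) m1) as [[E _]|[-> ->]]; auto.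
  exfalso. apply Nql, sigma_inj; auto.
Qed.

(* Comparing the point masses of the laws with three and with two edges at
   (th' q q) isolates p' q q, and then pi' q. *)
Lemma diag_params_match q : (q < Q)%nat ->
  pi' q = pi (sigma q) /\ p' q q = p (sigma q) (sigma q).
Proof.
  intros Hq. destruct (sigma_spec q Hq) as [Sq Es]. set (a := sigma q) in *.
  pose proof (law3 (fun t => t = th' q q) (fun t => t = th' q q) (fun t => t = th' q q)) as E3.
  pose proof (law2 (fun t => t = th' q q) (fun t => t = th' q q)) as E2.
  rewrite Psi_point_diag in E3, E2 by assumption.
  rewrite <- Es in E3, E2. rewrite Psi_point_diag in E3, E2 by assumption.
  unfold edge in E3. rewrite <- Es, dirac_self in E3.
  pose proof (valid_pi_pos Hv a Sq). pose proof (valid_pi_pos Hv' q Hq).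
  pose proof (valid_p_pos Hv a a Sq Sq). pose proof (valid_p_pos Hv' q q Hq Hq).
  assert (Ep : p' q q = p a a).
  { apply (Rmult_eq_reg_l (pi' q * pi' q * pi' q * (p' q q * p' q q * 1))).
    - rewrite <- E2 at 2. lra.
    - apply Rgt_not_eq. repeat apply Rmult_lt_0_compat; lra. }
  split; [|exact Ep].
  apply cube_inj; [lra | lra |]. rewrite Ep in E2.
  apply (Rmult_eq_reg_r (p a a * p a a * 1)); [lra |].
  apply Rgt_not_eq. repeat apply Rmult_lt_0_compat; lra.
Qed.

Lemma offdiag_params_match q l : (q < Q)%nat -> (l < Q)%nat ->
  p' q l = p (sigma q) (sigma l).
Proof.
  intros Hq Hl. destruct (Nat.eq_dec q l) as [<-|Nql]; [apply diag_params_match, Hq|].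
  destruct (sigma_spec q Hq) as [Sq _], (sigma_spec l Hl) as [Sl _].
  assert (Nab : sigma q <> sigma l) by (intros E; apply Nql, sigma_inj; auto).
  pose proof (law2 (fun t => t = th' q q) (fun t => t = th' q l)) as E2.
  rewrite Psi_point_offdiag in E2 by assumption.
  rewrite (theta_match q q), (theta_match q l), Psi_point_offdiag in E2 by assumption.
  destruct (diag_params_match q Hq) as [D1 D2], (diag_params_match l Hl) as [D3 _].
  rewrite <- D1, <- D2, <- D3 in E2.
  pose proof (valid_pi_pos Hv' q Hq). pose proof (valid_pi_pos Hv' l Hl).
  pose proof (valid_p_pos Hv' q q Hq Hq).
  symmetry. apply (Rmult_eq_reg_l (pi' q * pi' q * pi' l * p' q q)); [lra |].
  apply Rgt_not_eq. repeat apply Rmult_lt_0_compat; lra.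
Qed.

Lemma params_identified : exists sigma : nat -> nat, is_perm Q sigma /\
    (forall q, (q < Q)%nat -> pi' q = pi (sigma q)) /\
    (forall q l, (q < Q)%nat -> (l < Q)%nat ->
       p' q l = p (sigma q) (sigma l) /\ th' q l = th (sigma q) (sigma l)).
Proof.
  exists sigma. split; [split|split].
  - intros q Hq. apply sigma_spec, Hq.
  - exact sigma_inj.
  - intros q Hq. apply diag_params_match, Hq.
  - intros q l Hq Hl. split; [apply offdiag_params_match | apply theta_match]; assumption.
Qed.

End Identification.

Lemma K3_law_Psi {X Theta : Type} (x0 : X) (F : Theta -> (X -> Prop) -> R) Q pi p th A1 A2 A3 :
  K3_law x0 F Q pi p th A1 A2 A3 =
  Psi Q pi (fun q l => mu x0 F p th q l A1) (fun q l => mu x0 F p th q l A2)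
    (fun q l => mu x0 F p th q l A3).
Proof. reflexivity. Qed.

Section EdgeLaws.
Context {X Theta : Type} {S : (X -> Prop) -> Prop} {x0 : X} {F : Theta -> (X -> Prop) -> R}.
Hypothesis HF : forall t, is_prob_measure S (F t).

Lemma mu_full p th : (fun q l => mu x0 F p th q l (fun _ => True)) = (fun _ _ => 1).
Proof.
  apply functional_extensionality; intros q; apply functional_extensionality; intros l.
  unfold mu, dirac, Defs.ind. rewrite (measure_full (HF _)).
  destruct (excluded_middle_informative True); [ring | tauto].
Qed.

Lemma mu_off_atom (HS : is_sigma_algebra S) (H0 : S (fun x => x = x0))
    (Hatom : forall t, F t (fun x => x = x0) = 0) p th A : S A ->
  (fun q l => mu x0 F p th q l (fun x => A x /\ x <> x0)) = edge p th (fun t => F t A).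
Proof.
  intros HA.
  apply functional_extensionality; intros q; apply functional_extensionality; intros l.
  unfold mu, edge, dirac, Defs.ind.
  rewrite (measure_remove_null_point HS (HF _)) by auto.
  destruct (excluded_middle_informative (A x0 /\ x0 <> x0)) as [[_ []]|_]; [reflexivity | ring].
Qed.

Context {Q : nat} {pi : nat -> R} {p : nat -> nat -> R} {th : nat -> nat -> Theta}.
Hypothesis Hv : valid_params Q pi p th.

Lemma valid_nonneg : (forall q, (q < Q)%nat -> 0 <= pi q) /\ nonneg_on Q p.
Proof.
  split; [intros q Hq | intros q l Hq Hl]; apply Rlt_le;
    [apply (valid_pi_pos Hv) | apply (valid_p_pos Hv)]; assumption.
Qed.

Lemma mu_nonneg A : S A -> nonneg_on Q (fun q l => mu x0 F p th q l A).
Proof.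
  intros HA q l Hq Hl. unfold mu.
  destruct Hv as [_ [_ Hp]]. destruct (Hp q l Hq Hl) as [[P1 P2] _].
  pose proof (measure_nonneg (HF (th q l)) A HA). pose proof (dirac_nonneg x0 A).
  nra.
Qed.

Lemma edge_dirac_nonneg B : nonneg_on Q (edge p th (fun t => dirac t B)).
Proof.
  intros q l Hq Hl. unfold edge.
  apply Rmult_le_pos; [apply (proj2 valid_nonneg q l Hq Hl) | apply dirac_nonneg].
Qed.

End EdgeLaws.

Theorem theorem5
  (X : Type) (S : (X -> Prop) -> Prop) (x0 : X)
  (Theta : Type) (F : Theta -> (X -> Prop) -> R)
  (HS : is_sigma_algebra S) (H0 : S (fun x => x = x0))
  (HF : forall t, is_prob_measure S (F t))
  (HA2i : forall t, F t (fun x => x = x0) = 0)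
  (HA2ii : mixtures_identifiable S F)
  (Q : nat) (HQ : (2 <= Q)%nat)
  (pi pi' : nat -> R) (p p' : nat -> nat -> R) (th th' : nat -> nat -> Theta)
  (Hv : valid_params Q pi p th) (Hv' : valid_params Q pi' p' th')
  (HA1 : thetas_distinct Q th) (HA1' : thetas_distinct Q th')
  (Hlaw : forall A1 A2 A3, S A1 -> S A2 -> S A3 ->
     K3_law x0 F Q pi p th A1 A2 A3 = K3_law x0 F Q pi' p' th' A1 A2 A3) :
  exists sigma : nat -> nat, is_perm Q sigma /\
    (forall q, (q < Q)%nat -> pi' q = pi (sigma q)) /\
    (forall q l, (q < Q)%nat -> (l < Q)%nat ->
       p' q l = p (sigma q) (sigma l) /\ th' q l = th (sigma q) (sigma l)).
Proof.
  assert (HQ0 : (0 < Q)%nat) by lia.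
  assert (Hoff : forall A, S A -> S (fun x => A x /\ x <> x0))
    by (intros A HA; apply (sigma_inter HS); [exact HA | apply (sigma_compl HS), H0]).
  destruct (valid_nonneg Hv) as [Hpi Hp], (valid_nonneg Hv') as [Hpi' Hp'].
  pose proof (mu_nonneg (x0 := x0) HF Hv) as Hmu. pose proof (mu_nonneg (x0 := x0) HF Hv') as Hmu'.
  pose proof (edge_dirac_nonneg Hv) as Hdir. pose proof (edge_dirac_nonneg Hv') as Hdir'.
  assert (law1 : forall B1 A2 A3, S A2 -> S A3 ->
    Psi Q pi (edge p th (fun t => dirac t B1)) (fun q l => mu x0 F p th q l A2)
      (fun q l => mu x0 F p th q l A3) =
    Psi Q pi' (edge p' th' (fun t => dirac t B1)) (fun q l => mu x0 F p' th' q l A2)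
      (fun q l => mu x0 F p' th' q l A3)).
  { intros B1 A2 A3 H2 H3. apply (Psi_dirac_edge1 HS HF HA2ii); auto.
    intros A1 H1. rewrite <- !(mu_off_atom HF HS H0 HA2i) by exact H1.
    rewrite <- !K3_law_Psi. apply Hlaw; auto. }
  assert (law2 : forall B1 B2 A3, S A3 ->
    Psi Q pi (edge p th (fun t => dirac t B1)) (edge p th (fun t => dirac t B2))
      (fun q l => mu x0 F p th q l A3) =
    Psi Q pi' (edge p' th' (fun t => dirac t B1)) (edge p' th' (fun t => dirac t B2))
      (fun q l => mu x0 F p' th' q l A3)).
  { intros B1 B2 A3 H3. apply (Psi_dirac_edge2 HS HF HA2ii); auto.
    intros A2 H2. rewrite <- !(mu_off_atom HF HS H0 HA2i) by exact H2. auto. }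
  apply (params_identified Hv Hv' HA1 HA1').
  - intros B1 B2 B3. apply (Psi_dirac_edge3 HS HF HA2ii); auto.
    intros A3 H3. rewrite <- !(mu_off_atom HF HS H0 HA2i) by exact H3. auto.
  - intros B1 B2. pose proof (law2 B1 B2 _ (sigma_full HS)) as E.
    rewrite !(mu_full HF) in E. exact E.
Qed.
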